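(* Assume $\sigma_1\ge\sigma_2$. Let $\mathcal M^{\uparrow}$, $\mathcal T$, $\widetilde{\mathcal T}$, $\mathcal B_i$, $\mathcal H_i^{+}$, $\mathcal H_i^{-}$ ($i\in\{1,2\}$) be the sets defined in the context. (i) If $r\in\big(0,\frac{L}{2\sigma_1}\big]$, then $\mathcal M^{\uparrow}\sqcup\{\mathbf x_1^*,\mathbf x_2^*\}$ is closed, $$\partial\mathcal M^{\uparrow}=\mathcal T\sqcup\{\mathbf x_1^*,\mathbf x_2^*\}\quad\text{and}\quad(\mathcal M^{\uparrow})^{\circ}=\widetilde{\mathcal T}.$$ (ii) If $r\in\big(\frac{L}{2\sigma_1},\frac{L}{2\sigma_2}\big]$, then $\mathcal M^{\uparrow}\sqcup\{\mathbf x_1^*\}$ is closed, $$\partial\mathcal M^{\uparrow}=\big[\partial\mathcal B_1\cap(\mathcal H_1^-)^c\big]\sqcup\mathcal T\sqcup\{\mathbf x_1^*\}\quad\text{and}\quad(\mathcal M^{\uparrow})^{\circ}=\big[\mathcal B_1\cap(\mathcal H_1^-)^c\big]\sqcup\big[\widetilde{\mathcal T}\cap\mathcal H_1^-\big].$$ (iii) If $r\in\Big(\frac{L}{2\sigma_2},\frac L2\big(\frac1{\sigma_1}+\frac1{\sigma_2}\big)\Big)$, then $\mathcal M^{\uparrow}$ is closed, $$\partial\mathcal M^{\uparrow}=\big[\partial\mathcal B_1\cap(\mathcal H_1^-)^c\big]\sqcup\big[\partial\mathcal B_2\cap(\mathcal H_2^+)^c\big]\sqcup\mathcal T\quad\text{and}$$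 $$(\mathcal M^{\uparrow})^{\circ}=\big[\mathcal B_1\cap(\mathcal H_1^-)^c\big]\sqcup\big[\mathcal B_2\cap(\mathcal H_2^+)^c\big]\sqcup\big[\widetilde{\mathcal T}\cap(\mathcal H_1^-\cap\mathcal H_2^+)\big].$$ (iv) If $r=\frac L2\big(\frac1{\sigma_1}+\frac1{\sigma_2}\big)$, then $\mathcal M^{\uparrow}=\Big\{\Big(\frac L2\big(\frac1{\sigma_1}-\frac1{\sigma_2}\big),\mathbf 0\Big)\Big\}$. (v) If $r\in\Big(\frac L2\big(\frac1{\sigma_1}+\frac1{\sigma_2}\big),\infty\Big)$, then $\mathcal M^{\uparrow}=\emptyset$.
   Context: Fix a positive integer $n$, real numbers $r,\sigma_1,\sigma_2,L>0$, and $\mathbf x_1^*=(-r,0,\dots,0)$, $\mathbf x_2^*=(r,0,\dots,0)\in\mathbb R^n$. Points are written $\mathbf x=(x_1,\tilde{\mathbf x})$ with $x_1\in\mathbb R$, $\tilde{\mathbf x}\in\mathbb R^{n-1}$; $\|\cdot\|$ is the Euclidean norm. $\mathcal E^c$, $\mathcal E^\circ$, $\overline{\mathcal E}$, $\partial\mathcal E=\overline{\mathcal E}\setminus\mathcal E^\circ$ are complement, interior, closure and boundary in $\mathbb R^n$; $\sqcup$ denotes a union of pairwise disjoint sets. $\angle(\mathbf u,\mathbf v)=\arccos\frac{\langle\mathbf u,\mathbf v\rangle}{\|\mathbf u\|\|\mathbf v\|}\in[0,\pi]$ for nonzero $\mathbf u,\mathbf v$. For $i\in\{1,2\}$: $\mathcal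 B_i=\{\mathbf x\in\mathbb R^n:\|\mathbf x-\mathbf x_i^*\|<L/\sigma_i\}$; $\tilde\phi_i(\mathbf x)=\arccos\big(\frac{\sigma_i}{L}\|\mathbf x-\mathbf x_i^*\|\big)$ for $\mathbf x\in\overline{\mathcal B}_i$; $\alpha_i(\mathbf x)=\angle(\mathbf x-\mathbf x_i^*,\mathbf x_2^*-\mathbf x_1^* )$ for $\mathbf x\ne\mathbf x_i^*$. For $\mathbf x\notin\{\mathbf x_1^*,\mathbf x_2^*\}$, $\psi(\mathbf x)=\pi-(\alpha_2(\mathbf x)-\alpha_1(\mathbf x))$. Outer approximation: $\mathcal M^{\uparrow}=\{\mathbf x\in\mathbb R^n:\tilde\phi_1(\mathbf x)+\tilde\phi_2(\mathbf x)\ge\psi(\mathbf x)\}$. Also $\widetilde{\mathcal T}=\{\mathbf x\in\mathbb R^n:\tilde\phi_1(\mathbf x)+\tilde\phi_2(\mathbf x)>\psi(\mathbf x)\}$. In these definitions $\mathbf x$ is implicitly required to lie in the common domain $(\overline{\mathcal B}_1\cap\overline{\mathcal B}_2)\setminus\{\mathbf x_1^*,\mathbf x_2^*\}$ of $\tilde\phi_1,\tilde\phi_2,\psi$. With $d_i(\mathbf x)=\|\mathbf x-\mathbf x_i^*\|$, $$\mathcal T=\Big\{\mathbf x\in\mathbb R^n:\tfrac{\|\mathbf x\|^2-r^2}{d_1^2(\mathbf x)d_2^2(\mathbf x)}+\tfrac{\sigma_1\sigma_2}{L^2}=\sqrt{\tfrac1{d_1^2(\mathbf x)}-\tfrac{\sigma_1^2}{L^2}}\cdot\sqrt{\tfrac1{d_2^2(\mathbf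 x)}-\tfrac{\sigma_2^2}{L^2}}\Big\},$$ where it is implicitly required that all expressions are defined (i.e. $\mathbf x\notin\{\mathbf x_1^*,\mathbf x_2^*\}$ and both radicands are nonnegative). Let $\gamma_i=L^2/\sigma_i^2$, $\beta=\sigma_2/\sigma_1$, $\lambda_1=\big(\frac{1+\beta}{1+2\beta}\big)\frac{\gamma_1}{2r}-\frac{r}{1+2\beta}$, $\lambda_2=-\big(\frac{1+\beta}{2+\beta}\big)\frac{\gamma_2}{2r}+\frac{\beta r}{2+\beta}$. For $i\in\{1,2\}$: $\mathcal H_i^+=\{\mathbf x\in\mathbb R^n:x_1\ge\lambda_i\}$ and $\mathcal H_i^-=\{\mathbf x\in\mathbb R^n:x_1\le\lambda_i\}$. *)

(* Defs.v *)
From HB Require Import structures.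
From mathcomp Require Import all_boot all_order all_algebra.
From mathcomp Require Import all_classical all_reals all_analysis.

Import Order.TTheory GRing.Theory Num.Theory.
Import numFieldNormedType.Exports.

Local Open Scope classical_set_scope.
Local Open Scope ring_scope.

(* R^n with n >= 1 is 'rV[R]_n.+1.  The library topology on it is the product
   topology, i.e. the usual one, but its norm `|x| is the sup norm; hence the
   Euclidean norm below. *)

Definition dotp {R : realType} {n : nat} (u v : 'rV[R]_n) : R :=
  \sum_(i < n) u 0 i * v 0 i.

Definition enorm {R : realType} {n : nat} (u : 'rV[R]_n) : R :=
  Num.sqrt (dotp u u).

Definition angle {R : realType} {n : nat} (u v : 'rV[R]_n) : R :=
  acos (dotp u v / (enorm u * enorm v)).

Definition boundary {X : topologicalType} (E : set X) : set X :=
  closure E `\` interior E.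

(* E is the union of the pairwise disjoint sets listed in s *)
Definition is_disjoint_union {X : Type} (E : set X) (s : seq (set X)) : Prop :=
  E = \big[setU/set0]_(A <- s) A /\ pairwise (@disj_set X) s.

Definition axis_point {R : realType} (n : nat) (c : R) : 'rV[R]_n.+1 :=
  \row_i (if i == 0 then c else 0).

Definition center1 {R : realType} (n : nat) (r : R) := axis_point n (- r).
Definition center2 {R : realType} (n : nat) (r : R) := axis_point n r.

Definition eball {R : realType} {n : nat} (c : 'rV[R]_n.+1) (sigma L : R) :
    set 'rV[R]_n.+1 :=
  [set x | enorm (x - c) < L / sigma].

(* used only for x in the closure of [eball c sigma L] *)
Definition phi {R : realType} {n : nat} (c : 'rV[R]_n.+1) (sigma L : R)
    (x : 'rV[R]_n.+1) : R :=
  acos (sigma / L * enorm (x - c)).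

(* alpha and psi are used only for x distinct from the centers involved *)
Definition alpha {R : realType} {n : nat} (c : 'rV[R]_n.+1) (r : R)
    (x : 'rV[R]_n.+1) : R :=
  angle (x - c) (center2 n r - center1 n r).

Definition psi {R : realType} {n : nat} (r : R) (x : 'rV[R]_n.+1) : R :=
  pi - (alpha (center2 n r) r x - alpha (center1 n r) r x).

Definition common_domain {R : realType} (n : nat) (r sigma1 sigma2 L : R) :
    set 'rV[R]_n.+1 :=
  (closure (eball (center1 n r) sigma1 L)
     `&` closure (eball (center2 n r) sigma2 L))
  `\` [set center1 n r; center2 n r].

Definition Mup {R : realType} (n : nat) (r sigma1 sigma2 L : R) :
    set 'rV[R]_n.+1 :=
  [set x | common_domain n r sigma1 sigma2 L x /\
     phi (center1 n r) sigma1 L x + phi (center2 n r) sigma2 L x >= psi r x].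

Definition Ttilde {R : realType} (n : nat) (r sigma1 sigma2 L : R) :
    set 'rV[R]_n.+1 :=
  [set x | common_domain n r sigma1 sigma2 L x /\
     phi (center1 n r) sigma1 L x + phi (center2 n r) sigma2 L x > psi r x].

(* Division and Num.sqrt are total, so the conditions under which the two sides
   of the equation are meaningful are stated explicitly. *)
Definition Tset {R : realType} (n : nat) (r sigma1 sigma2 L : R) :
    set 'rV[R]_n.+1 :=
  [set x | let d1 := enorm (x - center1 n r) in
           let d2 := enorm (x - center2 n r) in
           let rad1 := 1 / d1 ^+ 2 - sigma1 ^+ 2 / L ^+ 2 in
           let rad2 := 1 / d2 ^+ 2 - sigma2 ^+ 2 / L ^+ 2 in
     [/\ x <> center1 n r, x <> center2 n r, 0 <= rad1, 0 <= rad2 &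
         (enorm x ^+ 2 - r ^+ 2) / (d1 ^+ 2 * d2 ^+ 2)
           + sigma1 * sigma2 / L ^+ 2
         = Num.sqrt rad1 * Num.sqrt rad2]].

Definition gamma {R : realType} (sigma L : R) : R := L ^+ 2 / sigma ^+ 2.

Definition lambda1 {R : realType} (r sigma1 sigma2 L : R) : R :=
  let beta := sigma2 / sigma1 in
  (1 + beta) / (1 + 2 * beta) * (gamma sigma1 L / (2 * r))
  - r / (1 + 2 * beta).

Definition lambda2 {R : realType} (r sigma1 sigma2 L : R) : R :=
  let beta := sigma2 / sigma1 in
  - ((1 + beta) / (2 + beta)) * (gamma sigma2 L / (2 * r))
  + beta * r / (2 + beta).

Definition Hplus {R : realType} (n : nat) (l : R) : set 'rV[R]_n.+1 :=
  [set x | l <= x 0 0].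

Definition Hminus {R : realType} (n : nat) (l : R) : set 'rV[R]_n.+1 :=
  [set x | x 0 0 <= l].

(* Main.v *)
Require Import Defs.
From HB Require Import structures.
From mathcomp Require Import all_boot all_order all_algebra.
From mathcomp Require Import all_classical all_reals all_analysis.
From mathcomp Require Import ring lra.

Import Order.TTheory GRing.Theory Num.Theory.
Import numFieldNormedType.Exports.

Local Open Scope classical_set_scope.
Local Open Scope ring_scope.

(** Write [d1], [d2] for the distances from a point to the two centers and
    [p = L / sigma1], [q = L / sigma2] for the radii.  The number [psi] is the
    supplement of the angle under which the point sees the two centers, so
    [cos psi = - <x - x1, x - x2> / (d1 * d2)], and [phi_i] is the arc cosine
    of [d_i] divided by the radius.  Both [psi] and [phi_1 + phi_2] lie in
    [[0, pi]], where [cos] decreases; comparing them therefore amounts to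
    reading off the sign of
    [gap = (d1^2 + d2^2) / 2 - 2 r^2 + d1^2 d2^2 / (p q)
           - d1 d2 sqrt (1 - (d1/p)^2) sqrt (1 - (d2/q)^2)].
    The outer approximation, [T] and [Ttilde] are the points of the closed
    balls with [gap <= 0], [gap = 0] and [gap < 0], the two centers being
    removed from the first two ([MupE], [TsetE], [TtildeE]).

    The gap extends continuously to the whole space and vanishes at the
    centers.  The closure of the outer approximation is thus contained in
    [gap <= 0] in the closed balls, and equal to it because a center lying in
    both closed balls is a limit of points of the segment joining the centers
    ([closure_Mup]).  Its interior is [gap < 0] in the open balls
    ([interior_Mup]).  The point to check is that a zero of the gap inside both
    balls is not interior: multiplying the gap by its conjugate yields a
    polynomial which, for fixed [d2], is quadratic in [d1^2] with positive
    leading coefficient, so near a zero it takes positive values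
    ([conj_product_pos_near]); a rotation about the second center changes
    [d1] at will while keeping [d2] ([gap0_not_interior]).

    It remains to understand the two spheres.  On [d1 = p] the square roots
    disappear and the gap is a positive multiple of [lambda1 - x_1]; moreover
    the gap is negative on the whole part of the closed ball lying beyond the
    hyperplane [x_1 = lambda1], and that part is inside the other open ball as
    long as [2 r < p + q] ([gap_beyond], [cut_sqr_dist_lt]).  It is empty when
    [2 r <= p], which together with the symmetric statement for the second ball
    separates the first three regimes.  When [p + q <= 2 r], the triangle inequality
    [2 r <= d1 + d2] leaves at most the point of the segment with [d1 = p] and
    [d2 = q]. *)

(** * The gap as a function of the two distances *)

Section Gap.
Context {R : realType}.
Implicit Types p q r d u v t : R.

Definition rational_part p q r (d1 d2 : R) : R :=
  (d1 ^+ 2 + d2 ^+ 2) / 2 - 2 * r ^+ 2 + d1 ^+ 2 * d2 ^+ 2 / (p * q).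

Definition root_part p d : R := d * Num.sqrt (1 - (d / p) ^+ 2).

Definition gap p q r (d1 d2 : R) : R :=
  rational_part p q r d1 d2 - root_part p d1 * root_part q d2.

(** The value of [d2^2] at which the gap changes sign on the sphere [d1 = p];
    the points of the sphere at that distance have first coordinate
    [lambda1]. *)
Definition cut_sqr_dist p q r : R := q * (4 * r ^+ 2 - p ^+ 2) / (q + 2 * p).

(** The product of the gap with its conjugate
    [rational_part + root_part * root_part], expanded as a polynomial in
    [u = d1^2] and [v = d2^2]; see [conj_productE]. *)
Definition conj_product p q r u v : R :=
  ((u + v) / 2 - 2 * r ^+ 2) ^+ 2
  + u * v * ((p^-1 + q^-1) * (u / p + v / q) - 1 - 4 * r ^+ 2 / (p * q)).

(** The gap is unchanged when the two balls are exchanged, so that every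
    result on the first sphere has a mirror image on the second. *)
Lemma gapC (p q r d1 d2 : R) : gap p q r d1 d2 = gap q p r d2 d1.
Proof. by rewrite /gap /rational_part (mulrC q p); ring. Qed.

Lemma root_part_ge0 p d : 0 <= d -> 0 <= root_part p d.
Proof. by move=> d0; rewrite mulr_ge0 ?sqrtr_ge0. Qed.

Lemma radicand_ge0 {p d} : 0 <= d -> d <= p -> 0 <= 1 - (d / p) ^+ 2.
Proof.
move=> d0 dp; have [p0|p0] := ltP 0 p.
  have : d / p <= 1 by rewrite ler_pdivrMr ?mul1r.
  have : 0 <= d / p by rewrite divr_ge0 // ltW.
  nra.
have -> : d = 0 by apply/eqP; rewrite eq_le d0 (le_trans dp).
by rewrite mul0r expr0n subr0.
Qed.

Lemma root_part_gt0 p d : 0 < d -> d < p -> 0 < root_part p d.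
Proof.
move=> d0 dp; have p0 := lt_trans d0 dp.
rewrite mulr_gt0 // sqrtr_gt0.
have : d / p < 1 by rewrite ltr_pdivrMr ?mul1r.
have : 0 < d / p by rewrite divr_gt0.
nra.
Qed.

Lemma root_part_radius p : 0 < p -> root_part p p = 0.
Proof.
by move=> p0; rewrite /root_part divff ?gt_eqF // expr1n subrr sqrtr0 mulr0.
Qed.

Lemma gap_center1 p q r : gap p q r 0 (2 * r) = 0.
Proof.
rewrite /gap /rational_part /root_part expr0n /= !mul0r !subr0 add0r !addr0.
by field.
Qed.

(** The root part vanishes at the radius, which leaves an affine function of
    [d2^2]. *)
Lemma gap_sphere (p q r d2 : R) : 0 < p -> 0 < q ->
  gap p q r p d2 = (q + 2 * p) / (2 * q) * (d2 ^+ 2 - cut_sqr_dist p q r).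
Proof.
move=> p0 q0; rewrite /gap root_part_radius // mul0r subr0 /rational_part /cut_sqr_dist.
by field; rewrite ?gt_eqF //; nra.
Qed.

Lemma gap_sphere_lt0 (p q r d2 : R) : 0 < p -> 0 < q ->
  (gap p q r p d2 < 0) = (d2 ^+ 2 < cut_sqr_dist p q r).
Proof.
by move=> p0 q0; rewrite gap_sphere // pmulr_rlt0 ?subr_lt0 // divr_gt0 //; nra.
Qed.

(** The difference of the two sides has the sign of [(p + q)^2 - (2 r)^2]. *)
Lemma cut_sqr_dist_lt p q r : 0 < p -> 0 < q -> 0 < r -> 2 * r < p + q ->
  cut_sqr_dist p q r < q ^+ 2.
Proof.
move=> p0 q0 r0 h; rewrite /cut_sqr_dist ltr_pdivrMr; last by nra.
rewrite -subr_gt0 (_ : _ - _ = q * ((p + q - 2 * r) * (p + q + 2 * r))); last by ring.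
by rewrite !mulr_gt0 ?subr_gt0 ?addr_gt0 ?mulr_gt0.
Qed.

Lemma cut_sqr_dist_le0 p q r : 0 < p -> 0 < q -> 0 < r -> 2 * r <= p ->
  cut_sqr_dist p q r <= 0.
Proof.
move=> p0 q0 r0 h; rewrite /cut_sqr_dist -mulrA mulr_ge0_le0 ?(ltW q0) //.
by rewrite mulr_le0_ge0 ?invr_ge0; nra.
Qed.

(** The gap is at most its rational part, which increases with [d1] and, on the
    sphere [d1 = p], is the gap itself. *)
Lemma gap_beyond (p q r d1 d2 : R) :
  0 < p -> 0 < q -> 0 <= d1 -> 0 <= d2 -> d1 <= p ->
  p ^+ 2 - cut_sqr_dist p q r < d1 ^+ 2 - d2 ^+ 2 ->
  d2 ^+ 2 < cut_sqr_dist p q r /\ gap p q r d1 d2 < 0.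
Proof.
move=> p0 q0 d10 d20 d1p hx.
have u_le : d1 ^+ 2 <= p ^+ 2 by rewrite ler_sqr ?nnegrE // ltW.
have v_lt : d2 ^+ 2 < cut_sqr_dist p q r by lra.
split=> //.
have rp : 0 <= root_part p d1 * root_part q d2 by rewrite mulr_ge0 ?root_part_ge0.
have := v_lt; rewrite -(gap_sphere_lt0 p q) // /gap root_part_radius // mul0r subr0.
suff : rational_part p q r d1 d2 <= rational_part p q r p d2 by lra.
rewrite /rational_part lerD // ?lerD //; last first.
  by rewrite ler_pM2r ?invr_gt0 ?mulr_gt0 // ler_wpM2r // sqr_ge0.
by rewrite ler_pM2r // lerD.
Qed.

(** On the segment joining the centers the rational part is
    [- d1 d2 (1 - d1 d2 / (p q))]. *)
Lemma gap_segment (p q r d1 d2 : R) :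
  0 < p -> 0 < q -> 0 <= d1 <= p -> 0 <= d2 <= q ->
  d1 + d2 = 2 * r -> gap p q r d1 d2 <= 0.
Proof.
move=> p0 q0 /andP[d10 d1p] /andP[d20 d2q] h.
have rp : 0 <= root_part p d1 * root_part q d2 by rewrite mulr_ge0 ?root_part_ge0.
suff : rational_part p q r d1 d2 <= 0 by rewrite /gap; lra.
have -> : rational_part p q r d1 d2 = - (d1 * d2) * (1 - (d1 * d2) / (p * q)).
  have -> : r = (d1 + d2) / 2 by lra.
  by rewrite /rational_part; field; rewrite !gt_eqF.
rewrite mulNr oppr_le0 mulr_ge0 ?mulr_ge0 // subr_ge0.
by rewrite ler_pdivrMr ?mulr_gt0 // mul1r ler_pM.
Qed.

Lemma conj_productE (p q r d1 d2 : R) :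
  0 < p -> 0 < q -> 0 <= d1 <= p -> 0 <= d2 <= q ->
  conj_product p q r (d1 ^+ 2) (d2 ^+ 2)
  = rational_part p q r d1 d2 ^+ 2 - (root_part p d1 * root_part q d2) ^+ 2.
Proof.
move=> p0 q0 /andP[d10 d1p] /andP[d20 d2q].
have root2 e d : 0 <= d -> d <= e -> root_part e d ^+ 2 = d ^+ 2 * (1 - (d / e) ^+ 2).
  by move=> d0 de; rewrite exprMn sqr_sqrtr // radicand_ge0.
rewrite exprMn !root2 // /conj_product /rational_part.
by field; rewrite !gt_eqF.
Qed.

Lemma conj_product_shift p q r u v t : 0 < p -> 0 < q ->
  conj_product p q r (u + t) v = conj_product p q r u v
   + t * ((4^-1 + (p^-1 + q^-1) * v / p) * t
          + ((u + v) / 2 - 2 * r ^+ 2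
             + v * ((p^-1 + q^-1) * (u / p + v / q) - 1 - 4 * r ^+ 2 / (p * q))
             + u * v * (p^-1 + q^-1) / p)).
Proof. by move=> p0 q0; rewrite /conj_product; field; rewrite !gt_eqF. Qed.

(** By [conj_product_shift] the polynomial is [t * (k * t + m)] with [k > 0] at
    [u + t], so a small [t] of the sign of [m] makes it positive. *)
Lemma conj_product_pos_near p q r u v (e : R) : 0 < p -> 0 < q -> 0 <= v -> 0 < e ->
  conj_product p q r u v = 0 -> exists2 t, `|t| < e & 0 < conj_product p q r (u + t) v.
Proof.
move=> p0 q0 v0 e0 w0.
pose k : R := 4^-1 + (p^-1 + q^-1) * v / p.
have k0 : 0 < k.
  by rewrite ltr_pwDl ?invr_gt0 // !mulr_ge0 ?addr_ge0 // ?invr_ge0 ltW.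
pose m : R := (u + v) / 2 - 2 * r ^+ 2
  + v * ((p^-1 + q^-1) * (u / p + v / q) - 1 - 4 * r ^+ 2 / (p * q))
  + u * v * (p^-1 + q^-1) / p.
have wE t : conj_product p q r (u + t) v = t * (k * t + m).
  by rewrite conj_product_shift // w0 add0r.
have ke := mulr_gt0 k0 e0.
have [m0|m0] := leP 0 m; [exists (e / 2) | exists (- (e / 2))].
- by rewrite gtr0_norm; lra.
- by rewrite wE mulr_gt0; lra.
- by rewrite normrN gtr0_norm; lra.
- by rewrite wE mulNr -mulrN mulr_gt0; lra.
Qed.

(** Equality would put the point on the axis through the centers: off the
    segment the conjugate product is [(d1 d2)^2 (d1/p + d2/q)^2 > 0], and on it
    the rational part is negative. *)
Lemma gap0_off_axis (p q r d1 d2 : R) : 0 < d1 < p -> 0 < d2 < q ->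
  gap p q r d1 d2 = 0 ->
  (d1 * d2) ^+ 2 != ((d1 ^+ 2 + d2 ^+ 2) / 2 - 2 * r ^+ 2) ^+ 2.
Proof.
move=> /andP[d10 d1p] /andP[d20 d2q] g0; apply/eqP => e.
have p0 := lt_trans d10 d1p; have q0 := lt_trans d20 d2q.
have low0 : 0 < rational_part p q r d1 d2.
  by rewrite (subr0_eq g0) mulr_gt0 // root_part_gt0.
have w0 : conj_product p q r (d1 ^+ 2) (d2 ^+ 2) = 0.
  by rewrite conj_productE ?(subr0_eq g0) ?subrr // !ltW.
have m0 : 0 < d1 * d2 by rewrite mulr_gt0.
have m1 : d1 * d2 / (p * q) < 1.
  by rewrite ltr_pdivrMr ?mulr_gt0 // mul1r ltr_pM // ltW.
move/eqP: e; rewrite eqf_sqr => /orP[]/eqP e.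
  have r2 : r ^+ 2 = (d1 ^+ 2 + d2 ^+ 2 - 2 * (d1 * d2)) / 4 by rewrite e; field.
  have : 0 < (d1 * d2) ^+ 2 * (d1 / p + d2 / q) ^+ 2.
    by rewrite mulr_gt0 ?exprn_gt0 // addr_gt0 ?divr_gt0.
  suff -> : (d1 * d2) ^+ 2 * (d1 / p + d2 / q) ^+ 2 = 0 by rewrite ltxx.
  by rewrite -w0 /conj_product r2; field; rewrite !gt_eqF.
have sE : (d1 ^+ 2 + d2 ^+ 2) / 2 - 2 * r ^+ 2 = - (d1 * d2) by rewrite e opprK.
move: low0; rewrite /rational_part sE -exprMn expr2 -mulrA; nra.
Qed.

End Gap.

(** * Distances and angles with respect to points of the first axis *)

Section AxialGeometry.
Context {R : realType} {n : nat}.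
Implicit Types (c r : R) (x : 'rV[R]_n.+1).

Definition off_axis x : R := \sum_(i < n) x 0 (lift ord0 i) ^+ 2.

Lemma off_axis_ge0 x : 0 <= off_axis x.
Proof. by apply: sumr_ge0 => i _; rewrite sqr_ge0. Qed.

Lemma enorm_ge0 x : 0 <= enorm x.
Proof. exact: sqrtr_ge0. Qed.

Lemma sqr_enorm x : enorm x ^+ 2 = dotp x x.
Proof. by rewrite sqr_sqrtr // sumr_ge0 // => i _; rewrite -expr2 sqr_ge0. Qed.

Lemma sqr_dist_axis c x :
  enorm (x - axis_point n c) ^+ 2 = (x 0 0 - c) ^+ 2 + off_axis x.
Proof.
rewrite sqr_enorm /dotp big_ord_recl !mxE /= expr2; congr (_ + _).
by apply: eq_bigr => i _; rewrite !mxE /= subr0 expr2.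
Qed.

Lemma enorm_eq0 x : (enorm x == 0) = (x == 0).
Proof.
apply/eqP/eqP => [x0|->]; last first.
  rewrite /enorm /dotp big1 ?sqrtr0 // => i _; by rewrite mxE mul0r.
have : dotp x x == 0 by rewrite -sqr_enorm x0 expr0n.
rewrite psumr_eq0 => [/allP h|i _]; last by rewrite -expr2 sqr_ge0.
apply/rowP => i; rewrite mxE; apply/eqP.
by have := h i; rewrite mem_index_enum -expr2 sqrf_eq0 => /(_ isT).
Qed.

Lemma sqr_enorm_axis x : enorm x ^+ 2 = x 0 0 ^+ 2 + off_axis x.
Proof.
by rewrite sqr_enorm /dotp big_ord_recl /= expr2.
Qed.

Definition dist1 r x := enorm (x - center1 n r).
Definition dist2 r x := enorm (x - center2 n r).

Lemma sqr_dist1 r x : dist1 r x ^+ 2 = (x 0 0 + r) ^+ 2 + off_axis x.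
Proof. by rewrite sqr_dist_axis opprK. Qed.

Lemma sqr_dist2 r x : dist2 r x ^+ 2 = (x 0 0 - r) ^+ 2 + off_axis x.
Proof. exact: sqr_dist_axis. Qed.

Lemma dist1_ge0 r x : 0 <= dist1 r x. Proof. exact: enorm_ge0. Qed.
Lemma dist2_ge0 r x : 0 <= dist2 r x. Proof. exact: enorm_ge0. Qed.

Lemma dist1_gt0 r x : (0 < dist1 r x) = (x != center1 n r).
Proof. by rewrite lt_def dist1_ge0 andbT enorm_eq0 subr_eq0. Qed.

Lemma dist2_gt0 r x : (0 < dist2 r x) = (x != center2 n r).
Proof. by rewrite lt_def dist2_ge0 andbT enorm_eq0 subr_eq0. Qed.

Lemma dist_sqrB r x : dist1 r x ^+ 2 - dist2 r x ^+ 2 = 4 * r * x 0 0.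
Proof. by rewrite sqr_dist1 sqr_dist2; ring. Qed.

Lemma dist_triangle r x : 0 < r -> 2 * r <= dist1 r x + dist2 r x.
Proof.
move=> r0.
have h1 : x 0 0 + r <= dist1 r x.
  rewrite (le_trans (ler_norm _)) // -ler_sqr ?nnegrE ?dist1_ge0 ?normr_ge0 //.
  by rewrite real_normK ?num_real // sqr_dist1 lerDl off_axis_ge0.
have h2 : r - x 0 0 <= dist2 r x.
  rewrite (le_trans (ler_norm _)) // -ler_sqr ?nnegrE ?dist2_ge0 ?normr_ge0 //.
  by rewrite real_normK ?num_real // sqr_dist2 -sqrrN opprB lerDl off_axis_ge0.
lra.
Qed.

(** Lagrange's identity for [x - x1] and [x - x2], the inner product of which is
    [(d1^2 + d2^2) / 2 - 2 r^2]. *)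
Lemma dist_cross r x :
  (dist1 r x * dist2 r x) ^+ 2
  - ((dist1 r x ^+ 2 + dist2 r x ^+ 2) / 2 - 2 * r ^+ 2) ^+ 2
  = 4 * r ^+ 2 * off_axis x.
Proof. by rewrite exprMn sqr_dist1 sqr_dist2; field. Qed.

Lemma axis_pointP x : off_axis x = 0 -> x = axis_point n (x 0 0).
Proof.
move=> /eqP; rewrite psumr_eq0 => [/allP h|i _]; last by rewrite sqr_ge0.
apply/rowP => i; rewrite mxE; case: (unliftP ord0 i) => [j ->|-> //] /=.
by apply/eqP; have := h j; rewrite mem_index_enum sqrf_eq0 => /(_ isT).
Qed.

Lemma off_axis_axis_point c : off_axis (axis_point n c) = 0.
Proof. by rewrite /off_axis big1 // => i _; rewrite mxE /= expr0n. Qed.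

Lemma dist1_axis_point r c : - r <= c -> dist1 r (axis_point n c) = r + c.
Proof.
move=> rc; apply: (pexpIrn (ltn0Sn 1)); rewrite ?nnegrE ?dist1_ge0 //; first lra.
by rewrite sqr_dist1 off_axis_axis_point mxE /=; ring.
Qed.

Lemma dist2_axis_point r c : c <= r -> dist2 r (axis_point n c) = r - c.
Proof.
move=> rc; apply: (pexpIrn (ltn0Sn 1)); rewrite ?nnegrE ?dist2_ge0 //; first lra.
by rewrite sqr_dist2 off_axis_axis_point mxE /=; ring.
Qed.

Lemma axis_point_line c d t :
  axis_point n c + t *: axis_point n d = axis_point n (c + t * d) :> 'rV[R]_n.+1.
Proof. by apply/rowP => i; rewrite !mxE; case: ifP => _ //; ring. Qed.

Lemma dist1_eq0 r x : dist1 r x = 0 -> x = center1 n r.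
Proof. by move/eqP; rewrite enorm_eq0 subr_eq0 => /eqP. Qed.

Lemma dist2_eq0 r x : dist2 r x = 0 -> x = center2 n r.
Proof. by move/eqP; rewrite enorm_eq0 subr_eq0 => /eqP. Qed.

Lemma dist1_center2 r : 0 < r -> dist1 r (center2 n r) = 2 * r.
Proof. by move=> r0; rewrite dist1_axis_point; [ring | lra]. Qed.

Lemma dist2_center1 r : 0 < r -> dist2 r (center1 n r) = 2 * r.
Proof. by move=> r0; rewrite dist2_axis_point; [ring | lra]. Qed.

Lemma dist1_center1 r : dist1 r (center1 n r) = 0.
Proof. by rewrite /dist1 subrr; apply/eqP; rewrite enorm_eq0. Qed.

Lemma dist2_center2 r : dist2 r (center2 n r) = 0.
Proof. by rewrite /dist2 subrr; apply/eqP; rewrite enorm_eq0. Qed.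

Lemma alphaE c r x : 0 < r ->
  alpha (axis_point n c) r x = acos ((x 0 0 - c) / enorm (x - axis_point n c)).
Proof.
move=> r0; rewrite /alpha /angle.
have -> : center2 n r - center1 n r = axis_point n (2 * r).
  by apply/rowP => i; rewrite !mxE; case: ifP => _; ring.
have -> : dotp (x - axis_point n c) (axis_point n (2 * r)) = (x 0 0 - c) * (2 * r).
  rewrite /dotp big_ord_recl !mxE /= big1 ?addr0 // => i _.
  by rewrite !mxE /= mulr0.
have -> : enorm (axis_point n (2 * r)) = 2 * r.
  apply: (pexpIrn (ltn0Sn 1)); rewrite ?nnegrE ?enorm_ge0 ?mulr_ge0 ?ltW //.
  by rewrite sqr_enorm_axis off_axis_axis_point mxE /= addr0.
by rewrite -mulf_div divff ?mulr1 // mulf_neq0 // gt_eqF.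
Qed.

Lemma cos_alpha_bounds c x (d := enorm (x - axis_point n c)) :
  -1 <= (x 0 0 - c) / d <= 1.
Proof.
rewrite -ler_norml -[leRHS]normr1 -ler_sqr ?nnegrE ?normr_ge0 //.
have [d0|d0] := eqVneq d 0; first by rewrite d0 invr0 mulr0 normr0 expr0n normr1 expr1n.
rewrite !real_normK ?num_real // expr_div_n expr1n ler_pdivrMr; last first.
  by rewrite exprn_gt0 // lt_def d0 enorm_ge0.
by rewrite mul1r sqr_dist_axis lerDl off_axis_ge0.
Qed.

Lemma sin_alpha c r x (d := enorm (x - axis_point n c)) : 0 < r -> 0 < d ->
  sin (alpha (axis_point n c) r x) = Num.sqrt (off_axis x) / d.
Proof.
move=> r0 d0; rewrite alphaE // sin_acos ?cos_alpha_bounds // -/d.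
have -> : 1 - ((x 0 0 - c) / d) ^+ 2 = off_axis x * d^-1 ^+ 2.
  have := sqr_dist_axis c x; rewrite -/d => dE.
  have -> : off_axis x = d ^+ 2 - (x 0 0 - c) ^+ 2 by rewrite dE; ring.
  by field; rewrite gt_eqF.
by rewrite sqrtrM ?off_axis_ge0 // sqrtr_sqr gtr0_norm ?invr_gt0.
Qed.

Lemma cos_alpha c r x : 0 < r ->
  cos (alpha (axis_point n c) r x) = (x 0 0 - c) / enorm (x - axis_point n c).
Proof.
move=> r0; rewrite alphaE // acosK // inE; apply/andP; exact/andP/cos_alpha_bounds.
Qed.

Lemma alpha_itv c r x : 0 < r -> 0 <= alpha (axis_point n c) r x <= pi.
Proof.
by move=> r0; rewrite alphaE // acos_ge0 ?acos_lepi // cos_alpha_bounds.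
Qed.

(** [z / sqrt (z^2 + w)] increases with [z], hence so does the cosine of the
    angle to the axis when the center moves left. *)
Lemma alpha_le r x : 0 < r -> 0 < dist1 r x -> 0 < dist2 r x ->
  alpha (center1 n r) r x <= alpha (center2 n r) r x.
Proof.
move=> r0 d10 d20; rewrite leNgt; apply/negP => lt21.
have : cos (alpha (center1 n r) r x) < cos (alpha (center2 n r) r x).
  by rewrite ltr_cos // inE; apply/alpha_itv.
rewrite !cos_alpha // -/(dist1 r x) -/(dist2 r x) opprK.
rewrite ltr_pdivrMr // mulrAC ltr_pdivlMr // => h.
have := sqr_dist1 r x; have := sqr_dist2 r x; have := off_axis_ge0 x.
move: (off_axis x) (dist1 r x) (dist2 r x) (x 0 0) d10 d20 h.
move=> w d1 d2 z d10 d20 h w0 e2 e1.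
(* the hypothesis h forces z - r and z + r to have the same sign *)
have [zr|zr] := leP 0 (z - r).
- have : ((z + r) * d2) ^+ 2 < ((z - r) * d1) ^+ 2.
    by rewrite ltr_pXn2r // nnegrE mulr_ge0 //; lra.
  have wrz : 0 <= w * (r * z) by rewrite !mulr_ge0 //; lra.
  rewrite !exprMn e1 e2; lra.
- have zr' : z + r <= 0.
    rewrite leNgt; apply/negP => zr'.
    have : 0 < (z + r) * d2 by rewrite mulr_gt0.
    have : (z - r) * d1 < 0 by rewrite nmulr_rlt0.
    lra.
  have : ((r - z) * d1) ^+ 2 < (- (z + r) * d2) ^+ 2.
    by rewrite ltr_pXn2r // ?nnegrE ?mulr_ge0 //; lra.
  have wrz : 0 <= w * (r * - z) by rewrite !mulr_ge0 //; lra.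
  rewrite !exprMn e1 e2; lra.
Qed.

Lemma psi_itv r x : 0 < r -> 0 < dist1 r x -> 0 < dist2 r x ->
  0 <= psi r x <= pi.
Proof.
move=> r0 d10 d20; have := alpha_le r x r0 d10 d20.
have /andP[] := alpha_itv (- r) r x r0; have /andP[] := alpha_itv r r x r0.
by rewrite /psi -/(center1 n r) -/(center2 n r); lra.
Qed.

(** The product of the sines is [off_axis x / (d1 * d2)], which completes the
    product of the cosines to the inner product of [x - x1] and [x - x2]. *)
Lemma cos_psi r x : 0 < r -> 0 < dist1 r x -> 0 < dist2 r x ->
  cos (psi r x) = - (((dist1 r x ^+ 2 + dist2 r x ^+ 2) / 2 - 2 * r ^+ 2)
                     / (dist1 r x * dist2 r x)).
Proof.
move=> r0 d10 d20; rewrite /psi cosB cospi sinpi mul0r addr0 mulN1r; congr (- _).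
rewrite cosB !cos_alpha // !sin_alpha // -/(dist1 r x) -/(dist2 r x) opprK.
rewrite !mulf_div -[Num.sqrt _ * Num.sqrt (off_axis x)]expr2.
rewrite sqr_sqrtr ?off_axis_ge0 // sqr_dist1 sqr_dist2.
by field; rewrite !gt_eqF.
Qed.

Lemma phi_itv (c : 'rV[R]_n.+1) (sigma L : R) x :
  0 < sigma -> 0 < L -> enorm (x - c) <= L / sigma ->
  0 <= phi c sigma L x <= pi / 2.
Proof.
move=> s0 L0 h.
have t0 : 0 <= sigma / L * enorm (x - c) by rewrite mulr_ge0 ?enorm_ge0 ?divr_ge0 ?ltW.
have t1 : sigma / L * enorm (x - c) <= 1.
  by rewrite -ler_pdivlMl ?divr_gt0 // invf_div mulr1.
have itv : -1 <= sigma / L * enorm (x - c) <= 1 by rewrite t1 andbT; lra.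
rewrite /phi acos_ge0 //= leNgt; apply/negP => h2.
have : cos (acos (sigma / L * enorm (x - c))) < cos (pi / 2).
  rewrite ltr_cos // ?in_itv /= ?acos_ge0 ?acos_lepi //.
  by have := @pi_ge0 R; move=> ?; apply/andP; split; lra.
by rewrite acosK ?in_itv // cos_pihalf; lra.
Qed.

Lemma cos_phiD (c1 c2 : 'rV[R]_n.+1) (sigma1 sigma2 L : R) x :
  0 < sigma1 -> 0 < sigma2 -> 0 < L ->
  enorm (x - c1) <= L / sigma1 -> enorm (x - c2) <= L / sigma2 ->
  cos (phi c1 sigma1 L x + phi c2 sigma2 L x)
  = (enorm (x - c1) / (L / sigma1)) * (enorm (x - c2) / (L / sigma2))
    - Num.sqrt (1 - (enorm (x - c1) / (L / sigma1)) ^+ 2)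
    * Num.sqrt (1 - (enorm (x - c2) / (L / sigma2)) ^+ 2).
Proof.
move=> s1 s2 L0 h1 h2.
have phiE (c : 'rV[R]_n.+1) (sigma : R) : 0 < sigma -> enorm (x - c) <= L / sigma ->
   cos (phi c sigma L x) = enorm (x - c) / (L / sigma) /\
   sin (phi c sigma L x) = Num.sqrt (1 - (enorm (x - c) / (L / sigma)) ^+ 2).
  move=> s0 h.
  have itv : -1 <= enorm (x - c) / (L / sigma) <= 1.
    rewrite ler_pdivrMr ?divr_gt0 // mul1r h andbT.
    by rewrite (@le_trans _ _ 0) ?divr_ge0 ?enorm_ge0 ?(ltW L0) ?(ltW s0) //; lra.
  by rewrite /phi mulrC -[sigma / L]invf_div acosK ?sin_acos ?in_itv.
have [c1E s1E] := phiE _ _ s1 h1; have [c2E s2E] := phiE _ _ s2 h2.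
by rewrite cosD c1E c2E s1E s2E.
Qed.

End AxialGeometry.

(** * Topology *)

Section Paths.
Context {R : realType} {X : topologicalType}.
Implicit Types (A : set X) (g : R -> X).

Lemma closure_path A g : {for 0, continuous g} ->
  (forall e, 0 < e -> exists2 t, `|t| < e & A (g t)) -> closure A (g 0).
Proof.
move=> gc h B /gc /nbhs_ballP[e /= e0 eB]; have [t te At] := h e e0.
by exists (g t); split=> //; apply: eB; rewrite /ball /= sub0r normrN.
Qed.

Lemma interior_path A g : {for 0, continuous g} -> interior A (g 0) ->
  exists2 e, 0 < e & forall t, `|t| < e -> A (g t).
Proof.
move=> gc /gc /nbhs_ballP[e /= e0 eB]; exists e => // t te.
by apply: eB; rewrite /ball /= sub0r normrN.
Qed.

Lemma open_sublevel (f : X -> R) c : continuous f -> open [set x | f x < c].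
Proof.
by move=> fc; apply: (@open_comp _ _ f [set y | y < c]) => // x _; exact: fc.
Qed.

Lemma closed_sublevel (f : X -> R) c : continuous f -> closed [set x | f x <= c].
Proof.
by move=> fc; apply: (@closed_comp _ _ f [set y | y <= c]) => // x _; exact: fc.
Qed.

End Paths.

Section Balls.
Context {R : realType} {n : nat}.
Implicit Types (c x v : 'rV[R]_n.+1) (s L : R).

(** The topology is that of the sup norm, so the continuity of the Euclidean
    distance comes from that of the coordinates. *)
Lemma continuous_dist c : continuous (fun x => enorm (x - c)).
Proof.
move=> x; rewrite /enorm.
apply: (@continuous_comp _ _ _
  (fun y : 'rV[R]_n.+1 => dotp (y - c) (y - c)) Num.sqrt);
  last exact: (@sqrt_continuous R).
apply: continuous_big => [|i _]; first exact: add_continuous.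
have subC : continuous (fun z : 'rV[R]_n.+1 => z 0 i - c 0 i).
  move=> y; apply: (@continuousB _ _ _ (fun z : 'rV[R]_n.+1 => z 0 i));
    last exact: cst_continuous.
  exact: (@coord_continuous R 1 n.+1 0 i).
move=> y; under eq_fun do rewrite !mxE -expr2.
apply: (@continuous_comp _ _ _
  (fun z : 'rV[R]_n.+1 => z 0 i - c 0 i) (fun t => t ^+ 2)).
  exact: subC.
exact: (@exprn_continuous R).
Qed.

Lemma continuous_line x v : continuous (fun t : R => x + t *: v).
Proof. by move=> t; apply: cvgD; [exact: cvg_cst | exact: scalel_continuous]. Qed.

Lemma enormZ (k : R) x : 0 <= k -> enorm (k *: x) = k * enorm x.
Proof.
move=> k0; apply: (pexpIrn (ltn0Sn 1)); rewrite ?nnegrE ?mulr_ge0 ?enorm_ge0 //.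
rewrite exprMn !sqr_enorm /dotp mulr_sumr; apply: eq_bigr => i _.
by rewrite !mxE; ring.
Qed.

Lemma line_to_center c x (t : R) : 0 <= 1 - t ->
  enorm (x + t *: (c - x) - c) = (1 - t) * enorm (x - c).
Proof.
move=> t1; rewrite -enormZ //; congr enorm.
by apply/rowP => i; rewrite !mxE; ring.
Qed.

Lemma open_eball c s L : open (eball c s L).
Proof. exact/open_sublevel/continuous_dist. Qed.

Lemma closure_eball c s L : 0 < L / s ->
  closure (eball c s L) = [set x | enorm (x - c) <= L / s].
Proof.
move=> p0; apply/seteqP; split.
  have cl := closed_sublevel _ (L / s) (continuous_dist c).
  by rewrite closureE; apply: smallest_sub => // x /ltW.
move=> x /= xp; rewrite -[x]addr0 -(scale0r (c - x)).
apply: (closure_path _ _ (continuous_line _ _ 0)) => e e0.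
exists (Num.min (e / 2) (1 / 2)).
  by rewrite gtr0_norm ?lt_min; [rewrite gt_min; lra | lra].
have : 0 < Num.min (e / 2) (1 / 2) <= 1 / 2 by rewrite lt_min ge_min lexx orbT; lra.
move: (Num.min _ _) => t /andP[t0 t1].
rewrite /eball /= line_to_center; last lra.
by have := enorm_ge0 (x - c); nra.
Qed.

Lemma boundary_eball c s L : 0 < L / s ->
  boundary (eball c s L) = [set x | enorm (x - c) = L / s].
Proof.
move=> p0; rewrite /boundary closure_eball // (interior_id _).1; last exact: open_eball.
apply/seteqP; split=> x; rewrite /eball /=.
  by case=> h1 /negP; rewrite -leNgt => h2; apply/eqP; rewrite eq_le h1.
by move=> ->; split=> //; rewrite ltxx.
Qed.

(** A subset of a closed ball has no interior point on the sphere: such a point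
    could be pushed away from the center. *)
Lemma interior_closed_ball c p x (A : set 'rV[R]_n.+1) : 0 < p ->
  A `<=` [set y | enorm (y - c) <= p] -> interior A x -> enorm (x - c) < p.
Proof.
move=> p0 Ap; rewrite -[x in interior _ x]addr0 -(scale0r (c - x)) => Ax.
have [e e0 he] := interior_path _ _ (continuous_line _ _ 0) Ax.
have /he/Ap /= : `|- (e / 2)| < e by rewrite normrN gtr0_norm; lra.
rewrite line_to_center; last lra.
have := enorm_ge0 (x - c) => d0 h.
by rewrite ltNge; apply/negP => pd; nra.
Qed.

End Balls.

(** * Rotation about the second center *)

Section Rotation.
Context {R : realType} {n : nat}.
Implicit Types (x : 'rV[R]_n.+1) (r h : R).

(** The squared distance to the axis left for a point of first coordinate
    [x 0 0 + h] on the sphere about [center2] through [x]. *)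
Definition off_axis_after r x h : R := off_axis x - 2 * h * (x 0 0 - r) - h ^+ 2.

(** Translate the first coordinate by [h] and scale the others by [k], so as to
    stay on the sphere about [center2] through [x]. *)
Definition rotation r x h : 'rV[R]_n.+1 :=
  let k := Num.sqrt (off_axis_after r x h / off_axis x) in
  k *: x + (x 0 0 + h - k * x 0 0) *: axis_point n 1.

Lemma rotation0 r x : off_axis x != 0 -> rotation r x 0 = x.
Proof.
move=> w0; rewrite /rotation /off_axis_after mulr0 mul0r expr0n !subr0 divff //.
by rewrite sqrtr1 mul1r addr0 subrr scale0r addr0 scale1r.
Qed.

Lemma continuous_off_axis_after r x : continuous (off_axis_after r x).
Proof.
rewrite /off_axis_after => h; apply: cvgB; last exact: exprn_continuous.
apply: cvgB; first exact: cvg_cst.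
by apply: cvgM; [exact: mulrl_continuous | exact: cvg_cst].
Qed.

Lemma continuous_rotation r x : continuous (rotation r x).
Proof.
have kc : continuous (fun h => Num.sqrt (off_axis_after r x h / off_axis x)).
  move=> h; apply: (@continuous_comp _ _ _
    (fun h => off_axis_after r x h / off_axis x)).
    apply: continuousM; first exact: continuous_off_axis_after.
    exact: cst_continuous.
  exact: sqrt_continuous.
move=> h; apply: cvgD; apply: cvgZr_tmp; first exact: kc.
apply: cvgB; first by apply: cvgD; [exact: cvg_cst | exact: cvg_id].
by apply: cvgM; [exact: kc | exact: cvg_cst].
Qed.

Lemma rotation_abscissa r x h : rotation r x h 0 0 = x 0 0 + h.
Proof. by rewrite !mxE /= mulr1 addrC subrK. Qed.

Lemma rotation_off_axis r x h : off_axis x != 0 -> 0 <= off_axis_after r x h ->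
  off_axis (rotation r x h) = off_axis_after r x h.
Proof.
move=> w0 a0; rewrite {1}/off_axis.
transitivity (\sum_(i < n) off_axis_after r x h / off_axis x * x 0 (lift ord0 i) ^+ 2).
  apply: eq_bigr => i _; rewrite !mxE /= mulr0 addr0 exprMn sqr_sqrtr //.
  by rewrite divr_ge0 // off_axis_ge0.
by rewrite -mulr_sumr -/(off_axis x) divfK.
Qed.

Lemma rotation_dist2 r x h : off_axis x != 0 -> 0 <= off_axis_after r x h ->
  dist2 r (rotation r x h) = dist2 r x.
Proof.
move=> w0 a0; apply: (pexpIrn (ltn0Sn 1)); rewrite ?nnegrE ?dist2_ge0 //.
rewrite !sqr_dist2 rotation_off_axis // rotation_abscissa /off_axis_after; ring.
Qed.

Lemma rotation_dist1 r x h : off_axis x != 0 -> 0 <= off_axis_after r x h ->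
  dist1 r (rotation r x h) ^+ 2 = dist1 r x ^+ 2 + 4 * r * h.
Proof.
move=> w0 a0; have := dist_sqrB r x; have := dist_sqrB r (rotation r x h).
by rewrite rotation_dist2 // rotation_abscissa; lra.
Qed.

End Rotation.

(** * The outer approximation in terms of the gap *)

Lemma continuous_gap {R : realType} {X : topologicalType} (p q r : R)
    (d1 d2 : X -> R) :
  continuous d1 -> continuous d2 -> continuous (fun x => gap p q r (d1 x) (d2 x)).
Proof.
have sqrc (d : X -> R) : continuous d -> continuous (fun x => d x ^+ 2).
  move=> dc x; apply: (@continuous_comp _ _ _ d (fun t => t ^+ 2)); first exact: dc.
  exact: exprn_continuous.
have rootc e (d : X -> R) : continuous d -> continuous (fun x => root_part e (d x)).
  rewrite /root_part => dc x; apply: cvgM; first exact: dc.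
  apply: (@continuous_comp _ _ _ (fun x => 1 - (d x / e) ^+ 2) Num.sqrt);
    last exact: sqrt_continuous.
  apply: cvgB; first exact: cvg_cst.
  apply: (@continuous_comp _ _ _ (fun x => d x / e) (fun t => t ^+ 2));
    last exact: exprn_continuous.
  by apply: cvgM; [exact: dc | exact: cvg_cst].
rewrite /gap /rational_part => d1c d2c x; apply: cvgB;
  last by apply: cvgM; exact: rootc.
apply: cvgD; last by apply: cvgM; [apply: cvgM; exact: sqrc | exact: cvg_cst].
apply: cvgB; last exact: cvg_cst.
by apply: cvgM; [apply: cvgD; exact: sqrc | exact: cvg_cst].
Qed.

Lemma is_disjoint_union2 {X : Type} (E A B : set X) :
  (forall x, E x <-> A x \/ B x) -> (forall x, A x -> B x -> False) ->
  is_disjoint_union E [:: A; B].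
Proof.
move=> EE AB; split.
  rewrite !big_cons big_nil setU0; apply/seteqP; split=> x.
    by move/EE.
  by move=> h; apply/EE.
by rewrite /= !andbT; apply/disj_setPS => x [/AB].
Qed.

Lemma is_disjoint_union3 {X : Type} (E A B C : set X) :
  (forall x, E x <-> [\/ A x, B x | C x]) ->
  (forall x, [/\ A x -> B x -> False, A x -> C x -> False & B x -> C x -> False]) ->
  is_disjoint_union E [:: A; B; C].
Proof.
move=> EE dis; split.
  rewrite !big_cons big_nil setU0; apply/seteqP; split=> x.
    by move/EE => [] ?; [left | right; left | right; right].
  move=> h; apply/EE.
  by case: h => [|[]] ?; [constructor 1 | constructor 2 | constructor 3].
rewrite /= !andbT; apply/andP; split; first (apply/andP; split);
  apply/disj_setPS => x [? ?]; case: (dis x) => d1 d2 d3;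
  first [exact: d1 | exact: d2 | exact: d3].
Qed.

Section Regions.
Context {R : realType} {n : nat}.

Definition in_balls (r s1 s2 L : R) (x : 'rV[R]_n.+1) :=
  (dist1 r x <= L / s1) && (dist2 r x <= L / s2).

Definition gap_at (r s1 s2 L : R) (x : 'rV[R]_n.+1) : R :=
  gap (L / s1) (L / s2) r (dist1 r x) (dist2 r x).

Variables (r s1 s2 L : R).
Hypotheses (r0 : 0 < r) (s10 : 0 < s1) (s20 : 0 < s2) (L0 : 0 < L).
Implicit Types x : 'rV[R]_n.+1.

Let p := L / s1.
Let q := L / s2.
Let M : set 'rV[R]_n.+1 := Mup n r s1 s2 L.
Let G := gap_at r s1 s2 L.
Let D := in_balls r s1 s2 L.

Let p0 : 0 < p. Proof. by rewrite divr_gt0. Qed.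
Let q0 : 0 < q. Proof. by rewrite divr_gt0. Qed.

Lemma common_domainE x : common_domain n r s1 s2 L x <->
  [/\ D x, 0 < dist1 r x & 0 < dist2 r x].
Proof.
rewrite /common_domain !closure_eball //= dist1_gt0 dist2_gt0; split.
  move=> [[h1 h2] h3]; split; first by rewrite /D /in_balls h1 h2.
    by apply/eqP => e; apply: h3; left.
  by apply/eqP => e; apply: h3; right.
by move=> [/andP[h1 h2] /eqP n1 /eqP n2]; split=> // -[].
Qed.

Lemma cos_gap x : D x -> 0 < dist1 r x -> 0 < dist2 r x ->
  cos (psi r x) - cos (phi (center1 n r) s1 L x + phi (center2 n r) s2 L x)
  = - G x / (dist1 r x * dist2 r x).
Proof.
move=> /andP[h1 h2] d1 d2; rewrite cos_psi // cos_phiD //.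
rewrite -/(dist1 r x) -/(dist2 r x) /G /gap_at /gap /rational_part /root_part -/p -/q.
by field; rewrite !gt_eqF.
Qed.

(** Each [phi] is at most [pi / 2], so [phi_1 + phi_2] and [psi] both lie in
    [[0, pi]], where the comparison passes to the cosines. *)
Lemma phi_psi_cmp x : D x -> 0 < dist1 r x -> 0 < dist2 r x ->
  let f := phi (center1 n r) s1 L x + phi (center2 n r) s2 L x in
  (psi r x <= f) = (G x <= 0) /\ (psi r x < f) = (G x < 0).
Proof.
move=> Dx d1 d2 f; have := cos_gap x Dx d1 d2; rewrite -/f => e.
have f_itv : f \in `[0, pi].
  move/andP: Dx => [/(phi_itv _ _ _ _ s10 L0) h1 /(phi_itv _ _ _ _ s20 L0) h2].
  by rewrite in_itv /=; move: h1 h2; rewrite /f; lra.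
have psi_in : psi r x \in `[0, pi] by rewrite in_itv /= psi_itv.
have m0 : 0 < dist1 r x * dist2 r x by rewrite mulr_gt0.
have GE : G x = (cos f - cos (psi r x)) * (dist1 r x * dist2 r x).
  by rewrite -opprB e; field; rewrite !gt_eqF.
split.
  by rewrite leNgt -ltr_cos // -leNgt GE pmulr_lle0 // subr_le0.
by rewrite -ltr_cos // GE pmulr_llt0 // subr_lt0.
Qed.

(** Both centers annihilate [gap_at], the square root terms being multiplied
    by the distances; hence they lie in the closed set cut out by the gap, and
    a negative gap already excludes them. *)
Lemma gap_at_center1 : G (center1 n r) = 0.
Proof. by rewrite /G /gap_at dist1_center1 dist2_center1 // gap_center1. Qed.

Lemma gap_at_center2 : G (center2 n r) = 0.
Proof. by rewrite /G /gap_at dist2_center2 dist1_center2 // gapC gap_center1. Qed.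

Lemma center1_in_balls : D (center1 n r) = (2 * r <= q).
Proof. by rewrite /D /in_balls dist1_center1 dist2_center1 // (ltW p0). Qed.

Lemma center2_in_balls : D (center2 n r) = (2 * r <= p).
Proof. by rewrite /D /in_balls dist2_center2 dist1_center2 // (ltW q0) andbT. Qed.

Lemma MupE x : M x <-> [/\ D x, 0 < dist1 r x, 0 < dist2 r x & G x <= 0].
Proof.
rewrite /M /Mup /=; split.
  by move=> [/common_domainE[Dx d1 d2]]; rewrite (phi_psi_cmp _ Dx d1 d2).1.
by move=> [Dx d1 d2 g]; rewrite common_domainE (phi_psi_cmp _ Dx d1 d2).1.
Qed.

Lemma TtildeE x : Ttilde n r s1 s2 L x <-> D x /\ G x < 0.
Proof.
rewrite /Ttilde /=; split.
  by move=> [/common_domainE[Dx d1 d2]]; rewrite (phi_psi_cmp _ Dx d1 d2).2.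
move=> [Dx g].
have d1 : 0 < dist1 r x.
  by rewrite dist1_gt0; apply: contraTneq g => ->; rewrite gap_at_center1 ltxx.
have d2 : 0 < dist2 r x.
  by rewrite dist2_gt0; apply: contraTneq g => ->; rewrite gap_at_center2 ltxx.
by rewrite common_domainE (phi_psi_cmp _ Dx d1 d2).2.
Qed.

(** Dividing the gap by [d1^2 d2^2] gives the defining equation; the radicands
    there are [(1 - (d_i / radius)^2) / d_i^2]. *)
Lemma TsetE x :
  Tset n r s1 s2 L x <-> [/\ D x, 0 < dist1 r x, 0 < dist2 r x & G x = 0].
Proof.
have radE s d : 0 < s -> 0 < d ->
    (0 <= 1 / d ^+ 2 - s ^+ 2 / L ^+ 2) = (d <= L / s) /\
    (d <= L / s -> Num.sqrt (1 / d ^+ 2 - s ^+ 2 / L ^+ 2)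
                   = root_part (L / s) d / d ^+ 2).
  move=> s0 d0.
  have -> : 1 / d ^+ 2 - s ^+ 2 / L ^+ 2 = d^-1 ^+ 2 * (1 - (d / (L / s)) ^+ 2).
    by field; rewrite !gt_eqF.
  split.
    have t0 : 0 <= d / (L / s) by rewrite ltW // !divr_gt0.
    rewrite pmulr_rge0 ?exprn_gt0 ?invr_gt0 // subr_ge0 expr_le1 //.
    by rewrite ler_pdivrMr ?divr_gt0 ?mul1r.
  move=> dp; rewrite sqrtrM ?sqr_ge0 // sqrtr_sqr gtr0_norm ?invr_gt0 // /root_part.
  by field; rewrite gt_eqF.
have eqE : 0 < dist1 r x -> 0 < dist2 r x -> D x ->
   let d1 := dist1 r x in let d2 := dist2 r x in
   ((enorm x ^+ 2 - r ^+ 2) / (d1 ^+ 2 * d2 ^+ 2) + s1 * s2 / L ^+ 2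
         - Num.sqrt (1 / d1 ^+ 2 - s1 ^+ 2 / L ^+ 2)
           * Num.sqrt (1 / d2 ^+ 2 - s2 ^+ 2 / L ^+ 2)
     = G x / (d1 ^+ 2 * d2 ^+ 2)).
  move=> d1 d2 /andP[h1 h2] /=; rewrite (radE _ _ s10 d1).2 // (radE _ _ s20 d2).2 //.
  have -> : enorm x ^+ 2 - r ^+ 2 = (dist1 r x ^+ 2 + dist2 r x ^+ 2) / 2 - 2 * r ^+ 2.
    by rewrite sqr_dist1 sqr_dist2 sqr_enorm_axis; field.
  by rewrite /G /gap_at /gap /rational_part; field; rewrite !gt_eqF.
rewrite /Tset /= -/(dist1 r x) -/(dist2 r x); split.
  move=> [/eqP]; rewrite -dist1_gt0 => d1 /eqP; rewrite -dist2_gt0 => d2.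
  rewrite (radE _ _ s10 d1).1 (radE _ _ s20 d2).1 => h1 h2 e.
  have Dx : D x by rewrite /D /in_balls h1.
  split=> //; have /= := eqE d1 d2 Dx; rewrite e subrr => /esym/eqP.
  by rewrite mulf_eq0 invr_eq0 mulf_eq0 !sqrf_eq0 !(gt_eqF d1, gt_eqF d2) !orbF => /eqP.
move=> [Dx d1 d2 g]; have /andP[h1 h2] := Dx.
split; try (by apply/eqP; rewrite -?dist1_gt0 -?dist2_gt0).
- by rewrite (radE _ _ s10 d1).1.
- by rewrite (radE _ _ s20 d2).1.
- by apply: subr0_eq; rewrite (eqE d1 d2 Dx) g mul0r.
Qed.

Lemma continuous_gap_at : continuous (G : 'rV[R]_n.+1 -> R).
Proof. by apply: continuous_gap; exact: continuous_dist. Qed.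

Lemma in_balls_closed : closed [set x | D x].
Proof.
have -> : [set x | D x] = [set x | dist1 r x <= p] `&` [set x | dist2 r x <= q].
  by apply/seteqP; split=> x /=; [move/andP | move=> [h1 h2]; apply/andP].
by apply: closedI; apply: closed_sublevel; exact: continuous_dist.
Qed.

Lemma segment_in_Mup c : - r < c < r -> r + c <= p -> r - c <= q ->
  M (axis_point n c).
Proof.
move=> /andP[rc cr] h1 h2; apply/MupE; rewrite /D /in_balls /G /gap_at.
rewrite dist1_axis_point ?dist2_axis_point ?(ltW rc) ?(ltW cr) //; split; try lra.
  by apply/andP.
by apply: gap_segment => //; rewrite ?h1 ?h2 ?andbT; lra.
Qed.

(** Slide along the segment towards the center; the constraint [d1 <= p] holds
    as soon as the point is close enough. *)
Lemma center1_closure : 2 * r <= q -> closure M (center1 n r).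
Proof.
move=> rq; have -> : center1 n r = axis_point n (- r) + 0 *: axis_point n 1.
  by rewrite scale0r addr0.
apply: (closure_path _ _ (continuous_line _ _ 0)) => e e0.
have : 0 < Num.min (e / 2) (Num.min r p) by rewrite !lt_min r0 p0; lra.
have : Num.min (e / 2) (Num.min r p) <= e / 2 by rewrite ge_min lexx.
have : Num.min (e / 2) (Num.min r p) <= r by rewrite !ge_min lexx orbT.
have : Num.min (e / 2) (Num.min r p) <= p by rewrite !ge_min lexx !orbT.
move: (Num.min _ _) => t tp tr te t0; exists t; first by rewrite gtr0_norm; lra.
by rewrite axis_point_line mulr1; apply: segment_in_Mup; lra.
Qed.

Lemma center2_closure : 2 * r <= p -> closure M (center2 n r).
Proof.
move=> rp; have -> : center2 n r = axis_point n r + 0 *: axis_point n (- 1).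
  by rewrite scale0r addr0.
apply: (closure_path _ _ (continuous_line _ _ 0)) => e e0.
have : 0 < Num.min (e / 2) (Num.min r q) by rewrite !lt_min r0 q0; lra.
have : Num.min (e / 2) (Num.min r q) <= e / 2 by rewrite ge_min lexx.
have : Num.min (e / 2) (Num.min r q) <= r by rewrite !ge_min lexx orbT.
have : Num.min (e / 2) (Num.min r q) <= q by rewrite !ge_min lexx !orbT.
move: (Num.min _ _) => t tq tr te t0; exists t; first by rewrite gtr0_norm; lra.
by rewrite axis_point_line mulrN1; apply: segment_in_Mup; lra.
Qed.

Lemma closure_Mup : closure M = [set x | D x /\ G x <= 0].
Proof.
apply/seteqP; split.
  rewrite closureE; apply: smallest_sub; last by move=> x /MupE[].
  apply: (@closedI _ [set x | D x] [set x | G x <= 0]); first exact: in_balls_closed.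
  exact: closed_sublevel continuous_gap_at.
move=> x [/= Dx g]; have /andP[h1 h2] := Dx.
have [d1|d1] := eqVneq (dist1 r x) 0.
  rewrite (dist1_eq0 _ _ d1) in h2 *; apply: center1_closure.
  by rewrite -(@dist2_center1 _ n).
have [d2|d2] := eqVneq (dist2 r x) 0.
  rewrite (dist2_eq0 _ _ d2) in h1 *; apply: center2_closure.
  by rewrite -(@dist1_center2 _ n).
have d10 : 0 < dist1 r x by rewrite lt_def d1 dist1_ge0.
have d20 : 0 < dist2 r x by rewrite lt_def d2 dist2_ge0.
exact/subset_closure/MupE.
Qed.

(** Were [x] interior, small rotations would keep it in the region; along them the
    rational part stays positive, so a nonpositive gap means a nonpositive
    conjugate product, against [conj_product_pos_near]. *)
Lemma gap0_not_interior x : interior M x -> dist1 r x < p -> dist2 r x < q ->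
  G x != 0.
Proof.
move=> Mx d1p d2q; apply/eqP => g0.
have /MupE[_ d10 d20 _] := interior_subset Mx.
have d1i : 0 < dist1 r x < p by rewrite d10.
have d2i : 0 < dist2 r x < q by rewrite d20.
have w0 : off_axis x != 0.
  apply: contra_eq_neq (dist_cross r x) => w0.
  by rewrite w0 mulr0 subr_eq0 (gap0_off_axis p q).
have low0 : 0 < rational_part p q r (dist1 r x) (dist2 r x).
  by rewrite (subr0_eq g0) mulr_gt0 // root_part_gt0.
have conj0 : conj_product p q r (dist1 r x ^+ 2) (dist2 r x ^+ 2) = 0.
  by rewrite conj_productE ?(subr0_eq g0) ?subrr // !ltW.
(* the rational part as a function of d1^2, d2 being kept by the rotation *)
pose lowE (u : R) :=
  (u + dist2 r x ^+ 2) / 2 - 2 * r ^+ 2 + u * dist2 r x ^+ 2 / (p * q).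
pose f h := lowE (dist1 r x ^+ 2 + 4 * r * h).
have near0 : \forall h \near (0 : R),
    [/\ M (rotation r x h), 0 < off_axis_after r x h & 0 < f h].
  have gtE (k : R -> R) : continuous k -> 0 < k 0 -> \forall h \near (0 : R), 0 < k h.
    by move=> kc k0; exact: (kc 0 _ (lt_nbhsr k0)).
  have M0 : \forall h \near (0 : R), M (rotation r x h).
    by apply: (continuous_rotation r x 0); rewrite rotation0.
  have a0 : \forall h \near (0 : R), 0 < off_axis_after r x h.
    apply: gtE; first exact: continuous_off_axis_after.
    by rewrite /off_axis_after mulr0 mul0r expr0n !subr0 lt_def w0 off_axis_ge0.
  have f0 : \forall h \near (0 : R), 0 < f h.
    apply: gtE; last by rewrite /f mulr0 addr0.
    rewrite /f /lowE => h; apply: cvgD.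
      apply: cvgB; last exact: cvg_cst.
      apply: cvgM; last exact: cvg_cst.
      apply: cvgD; last exact: cvg_cst.
      by apply: cvgD; [exact: cvg_cst | exact: mulrl_continuous].
    apply: cvgM; last exact: cvg_cst.
    apply: cvgM; last exact: cvg_cst.
    by apply: cvgD; [exact: cvg_cst | exact: mulrl_continuous].
  by near=> h; split; near: h.
have /nbhs_ballP[e /= e0 he] := near0.
have r40 : 0 < 4 * r by rewrite mulr_gt0.
(* a rotation by h changes d1^2 by 4 r h *)
have [t te wt] := conj_product_pos_near p q r _ _ (4 * r * e) p0 q0 (sqr_ge0 _)
  (mulr_gt0 r40 e0) conj0.
have [|/MupE[/andP[h1 h2] d1' d2' g] /ltW a0 f0] := he (t / (4 * r)).
  rewrite /ball /= sub0r normrN normrM normfV [`|4 * r|]gtr0_norm //.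
  by rewrite ltr_pdivrMr // mulrC.
have tE : 4 * r * (t / (4 * r)) = t by rewrite mulrC divfK // gt_eqF.
have := rotation_dist1 r x _ w0 a0; rewrite tE => e1.
have e2 := rotation_dist2 r x _ w0 a0.
move: wt f0 g; rewrite /G /gap_at -/p -/q /f /lowE tE -e1 -e2.
rewrite conj_productE ?h1 ?h2 ?(ltW d1') ?(ltW d2') // -/(rational_part _ _ _ _ _) /gap.
move: (rational_part _ _ _ _ _) (_ * root_part _ _) => a b ab a_gt0 le_ab.
have b_ge0 : 0 <= b by lra.
suff : a ^+ 2 <= b ^+ 2 by rewrite leNgt -subr_gt0 ab.
by rewrite ler_sqr ?nnegrE ?(ltW a_gt0) // -subr_le0.
Unshelve. all: by end_near.
Qed.

Lemma interior_Mup :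
  interior M = [set x | [/\ dist1 r x < p, dist2 r x < q & G x < 0]].
Proof.
apply/seteqP; split=> [x Mx|].
   have /MupE[_ _ _ g] := interior_subset Mx.
  have d1 : dist1 r x < p.
    by apply: (interior_closed_ball _ _ _ _ p0 _ Mx) => y /MupE[/andP[]].
  have d2 : dist2 r x < q.
    by apply: (interior_closed_ball _ _ _ _ q0 _ Mx) => y /MupE[/andP[]].
  by split=> //; rewrite lt_neqAle g gap0_not_interior.
have -> : [set y | [/\ dist1 r y < p, dist2 r y < q & G y < 0]] =
  ([set y | dist1 r y < p] `&` [set y | dist2 r y < q]) `&` [set y | G y < 0].
  by apply/seteqP; split=> y /=; [case | case; case].
rewrite -open_subsetE => [y [[/ltW h1 /ltW h2] g]|].
  have Dy : D y by apply/andP.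
  have [/common_domainE[_ d1 d2] _] : Ttilde n r s1 s2 L y by apply/TtildeE.
  by apply/MupE; split=> //; exact: ltW.
by apply: openI; [apply: openI|]; apply: open_sublevel;
  [exact: continuous_dist | exact: continuous_dist | exact: continuous_gap_at].
Qed.

Lemma boundary_MupE x : boundary M x <->
  [/\ D x, G x <= 0 & [\/ dist1 r x = p, dist2 r x = q | G x = 0]].
Proof.
rewrite /boundary closure_Mup interior_Mup /=; split.
  move=> [[Dx g] nint]; split=> //; have /andP[h1 h2] := Dx.
  have [->|n1] := eqVneq (dist1 r x) p; first by constructor 1.
  have [->|n2] := eqVneq (dist2 r x) q; first by constructor 2.
  have [->|n3] := eqVneq (G x) 0; first by constructor 3.
  by exfalso; apply: nint; split; rewrite lt_neqAle ?n1 ?n2 ?n3.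
move=> [Dx g h]; split=> // -[h1 h2 h3]; case: h => e.
- by rewrite e ltxx in h1.
- by rewrite e ltxx in h2.
- by rewrite e ltxx in h3.
Qed.

(** * The spheres and the hyperplanes *)

(** Since [d1^2 - d2^2 = 4 r x_1], both hyperplanes are level sets of
    [d1^2 - d2^2]. *)
Lemma lambda1E x : (lambda1 r s1 s2 L < x 0 0) =
  (p ^+ 2 - cut_sqr_dist p q r < dist1 r x ^+ 2 - dist2 r x ^+ 2).
Proof.
rewrite dist_sqrB -(ltr_pM2l (_ : 0 < 4 * r)) ?mulr_gt0 //; congr (_ < _).
rewrite /lambda1 /gamma /cut_sqr_dist /p /q.
have n1 : 0 < s1 + 2 * s2 by rewrite addr_gt0 ?mulr_gt0.
have n2 : 0 < L * s1 + 2 * L * s2 by rewrite addr_gt0 ?mulr_gt0.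
by field; rewrite (gt_eqF s10) (gt_eqF s20) (gt_eqF n1) (gt_eqF n2) (gt_eqF r0).
Qed.

Lemma lambda2E x : (x 0 0 < lambda2 r s1 s2 L) =
  (q ^+ 2 - cut_sqr_dist q p r < dist2 r x ^+ 2 - dist1 r x ^+ 2).
Proof.
rewrite -(opprB (dist1 r x ^+ 2)) dist_sqrB ltrNr.
rewrite -[x 0 0 < _](ltr_pM2l (_ : 0 < 4 * r)) ?mulr_gt0 //.
congr (_ < _); rewrite /lambda2 /gamma /cut_sqr_dist /p /q.
have n1 : 0 < 2 * s1 + s2 by rewrite addr_gt0 ?mulr_gt0.
have n2 : 0 < L * s2 + 2 * L * s1 by rewrite addr_gt0 ?mulr_gt0.
by field; rewrite (gt_eqF s10) (gt_eqF s20) (gt_eqF n1) (gt_eqF n2) (gt_eqF r0).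
Qed.

Lemma gap_sphere1 x : dist1 r x = p ->
  (G x < 0) = (dist2 r x ^+ 2 < cut_sqr_dist p q r).
Proof. by move=> e; rewrite /G /gap_at e gap_sphere_lt0. Qed.

Lemma gap_sphere2 x : dist2 r x = q ->
  (G x < 0) = (dist1 r x ^+ 2 < cut_sqr_dist q p r).
Proof. by move=> e; rewrite /G /gap_at e gapC gap_sphere_lt0. Qed.

Lemma gap_sphere1_lambda1 x : dist1 r x = p -> (G x < 0) = (lambda1 r s1 s2 L < x 0 0).
Proof. by move=> e; rewrite lambda1E gap_sphere1 // e; apply/idP/idP; lra. Qed.

Lemma gap_sphere2_lambda2 x : dist2 r x = q -> (G x < 0) = (x 0 0 < lambda2 r s1 s2 L).
Proof. by move=> e; rewrite lambda2E gap_sphere2 // e; apply/idP/idP; lra. Qed.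

Lemma gap_sphere1_ge0 x : 2 * r <= p -> dist1 r x = p -> 0 <= G x.
Proof.
move=> rp e; rewrite leNgt gap_sphere1 // -leNgt.
by rewrite (le_trans (cut_sqr_dist_le0 _ _ _ p0 q0 r0 rp)) ?sqr_ge0.
Qed.

Lemma gap_sphere2_ge0 x : 2 * r <= q -> dist2 r x = q -> 0 <= G x.
Proof.
move=> rp e; rewrite leNgt gap_sphere2 // -leNgt.
by rewrite (le_trans (cut_sqr_dist_le0 _ _ _ q0 p0 r0 rp)) ?sqr_ge0.
Qed.

Lemma beyond_lambda1 x : 2 * r < p + q -> dist1 r x <= p ->
  lambda1 r s1 s2 L < x 0 0 -> dist2 r x < q /\ G x < 0.
Proof.
move=> rpq h1; rewrite lambda1E => h.
have [h2 g] := gap_beyond _ _ _ _ _ p0 q0 (dist1_ge0 r x) (dist2_ge0 r x) h1 h.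
split=> //; have := lt_trans h2 (cut_sqr_dist_lt _ _ _ p0 q0 r0 rpq).
by rewrite ltr_sqr ?nnegrE ?dist2_ge0 ?ltW.
Qed.

Lemma beyond_lambda2 x : 2 * r < p + q -> dist2 r x <= q ->
  x 0 0 < lambda2 r s1 s2 L -> dist1 r x < p /\ G x < 0.
Proof.
rewrite addrC => rpq h1; rewrite lambda2E => h.
have [h2 g] := gap_beyond _ _ _ _ _ q0 p0 (dist2_ge0 r x) (dist1_ge0 r x) h1 h.
split; last by rewrite /G /gap_at gapC.
have := lt_trans h2 (cut_sqr_dist_lt _ _ _ q0 p0 r0 rpq).
by rewrite ltr_sqr ?nnegrE ?dist1_ge0 ?ltW.
Qed.

(** The two conditions add up to
    [p^2 + q^2 < cut_sqr_dist p q r + cut_sqr_dist q p r], against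
    [cut_sqr_dist_lt]. *)
Lemma lambda_disjoint x : 2 * r < p + q -> lambda1 r s1 s2 L < x 0 0 ->
  x 0 0 < lambda2 r s1 s2 L -> False.
Proof.
rewrite lambda1E lambda2E => rpq.
have := cut_sqr_dist_lt _ _ _ p0 q0 r0 rpq; have := cut_sqr_dist_lt q p r q0 p0 r0.
by rewrite [q + p]addrC => /(_ rpq); lra.
Qed.

Let B1 : set 'rV[R]_n.+1 := eball (center1 n r) s1 L.
Let B2 : set 'rV[R]_n.+1 := eball (center2 n r) s2 L.
Let H1m : set 'rV[R]_n.+1 := Hminus n (lambda1 r s1 s2 L).
Let H2p : set 'rV[R]_n.+1 := Hplus n (lambda2 r s1 s2 L).
Let T : set 'rV[R]_n.+1 := Tset n r s1 s2 L.
Let Tt : set 'rV[R]_n.+1 := Ttilde n r s1 s2 L.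

Lemma disjoint_center1 x : M x \/ T x -> x = center1 n r -> False.
Proof.
move=> h /eqP; rewrite -[_ == _]negbK -dist1_gt0 => /negP; apply.
by case: h => [/MupE[]|/TsetE[]].
Qed.

Lemma disjoint_center2 x : M x \/ T x -> x = center2 n r -> False.
Proof.
move=> h /eqP; rewrite -[_ == _]negbK -dist2_gt0 => /negP; apply.
by case: h => [/MupE[]|/TsetE[]].
Qed.

Lemma gap0_cases x : D x -> G x = 0 -> [\/ T x, x = center1 n r | x = center2 n r].
Proof.
move=> Dx g; have [->|n1] := eqVneq x (center1 n r); first by constructor 2.
have [->|n2] := eqVneq x (center2 n r); first by constructor 3.
by constructor 1; apply/TsetE; rewrite dist1_gt0 dist2_gt0.
Qed.

Lemma closure_Mup_cases x : closure M x <->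
  [\/ M x, x = center1 n r /\ 2 * r <= q | x = center2 n r /\ 2 * r <= p].
Proof.
rewrite closure_Mup /=; split.
  move=> [Dx g].
  have [e|n1] := eqVneq x (center1 n r).
    by constructor 2; split=> //; rewrite -center1_in_balls -e.
  have [e|n2] := eqVneq x (center2 n r).
    by constructor 3; split=> //; rewrite -center2_in_balls -e.
  by constructor 1; apply/MupE; rewrite dist1_gt0 dist2_gt0.
case=> [/MupE[]//|[-> rq]|[-> rp]].
  by rewrite center1_in_balls gap_at_center1.
by rewrite center2_in_balls gap_at_center2.
Qed.

Lemma Hminus_compl x : (~` H1m) x <-> lambda1 r s1 s2 L < x 0 0.
Proof. by rewrite /H1m /Hminus /= ltNge; split=> /negP. Qed.

Lemma Hplus_compl x : (~` H2p) x <-> x 0 0 < lambda2 r s1 s2 L.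
Proof. by rewrite /H2p /Hplus /= ltNge; split=> /negP. Qed.

(** The boundary points of negative gap on the first sphere: such a point lies
    in [Ttilde], but arbitrarily close points are outside the ball. *)
Lemma sphere1_part x : 2 * r < p + q ->
  [/\ D x, G x < 0 & dist1 r x = p] <-> (boundary B1 `&` ~` H1m) x.
Proof.
move=> rpq; rewrite boundary_eball //; split.
  by move=> [_ g e]; split=> //; apply/Hminus_compl; rewrite -gap_sphere1_lambda1.
move=> [/= e /Hminus_compl h]; have [|h2 g] := beyond_lambda1 x rpq _ h.
  by rewrite /dist1 e.
by split=> //; apply/andP; split; [rewrite /dist1 e | exact: ltW].
Qed.

Lemma sphere2_part x : 2 * r < p + q ->
  [/\ D x, G x < 0 & dist2 r x = q] <-> (boundary B2 `&` ~` H2p) x.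
Proof.
move=> rpq; rewrite boundary_eball //; split.
  by move=> [_ g e]; split=> //; apply/Hplus_compl; rewrite -gap_sphere2_lambda2.
move=> [/= e /Hplus_compl h]; have [|h1 g] := beyond_lambda2 x rpq _ h.
  by rewrite /dist2 e.
by split=> //; apply/andP; split; [exact: ltW | rewrite /dist2 e].
Qed.

(** The three regimes share this description; each of them makes some of the
    five pieces empty. *)
Lemma boundary_Mup_cases x : 2 * r < p + q -> boundary M x <->
  [\/ T x, x = center1 n r /\ 2 * r <= q \/ x = center2 n r /\ 2 * r <= p,
      (boundary B1 `&` ~` H1m) x | (boundary B2 `&` ~` H2p) x].
Proof.
move=> rpq; split.
  move=> /boundary_MupE[Dx]; rewrite le_eqVlt => /orP[/eqP g _|g h].
    case: (gap0_cases x Dx g) => [|e|e]; first by constructor 1.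
      by constructor 2; left; split=> //; rewrite -center1_in_balls -e.
    by constructor 2; right; split=> //; rewrite -center2_in_balls -e.
  case: h => e; last by rewrite e ltxx in g.
    by constructor 3; apply/sphere1_part.
  by constructor 4; apply/sphere2_part.
move=> h; apply/boundary_MupE.
case: h => [/TsetE[Dx _ _ g]|[[-> h]|[-> h]]|h|h].
- by split; rewrite // ?[G x]g //; constructor 3.
- by rewrite center1_in_balls gap_at_center1; split=> //; constructor 3.
- by rewrite center2_in_balls gap_at_center2; split=> //; constructor 3.
- have [Dx g e] := (sphere1_part x rpq).2 h.
  by split; [|exact: ltW|constructor 1].
- have [Dx g e] := (sphere2_part x rpq).2 h.
  by split; [|exact: ltW|constructor 2].
Qed.

Lemma sphere1_part_empty x : 2 * r <= p -> ~ (boundary B1 `&` ~` H1m) x.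
Proof.
move=> rp; have rpq : 2 * r < p + q by rewrite (le_lt_trans rp) // ltrDl.
by move=> /(sphere1_part _ rpq)[_ g e]; have := gap_sphere1_ge0 x rp e; rewrite leNgt g.
Qed.

Lemma sphere2_part_empty x : 2 * r <= q -> ~ (boundary B2 `&` ~` H2p) x.
Proof.
move=> rq; have rpq : 2 * r < p + q by rewrite (le_lt_trans rq) // ltrDr.
by move=> /(sphere2_part _ rpq)[_ g e]; have := gap_sphere2_ge0 x rq e; rewrite leNgt g.
Qed.

Lemma interior_MupE x : interior M x <-> [/\ Tt x, B1 x & B2 x].
Proof.
rewrite interior_Mup /=; split.
  move=> [h1 h2 g]; split=> //; apply/TtildeE; split=> //.
  by apply/andP; split; exact: ltW.
by move=> [/TtildeE[_ g] h1 h2].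
Qed.

Lemma beyond_H1m x : 2 * r < p + q -> B1 x -> (~` H1m) x -> Tt x /\ B2 x.
Proof.
move=> rpq b1 /Hminus_compl h; have [h2 g] := beyond_lambda1 x rpq (ltW b1) h.
by split=> //; apply/TtildeE; split=> //; apply/andP; split; exact: ltW.
Qed.

Lemma beyond_H2p x : 2 * r < p + q -> B2 x -> (~` H2p) x -> Tt x /\ B1 x.
Proof.
move=> rpq b2 /Hplus_compl h; have [h1 g] := beyond_lambda2 x rpq (ltW b2) h.
by split=> //; apply/TtildeE; split=> //; apply/andP; split; exact: ltW.
Qed.

Lemma Ttilde_eball1 x : Tt x -> H1m x \/ 2 * r <= p -> B1 x.
Proof.
move=> /TtildeE[Dx g] h; have /andP[h1 _] := Dx.
rewrite /B1 /eball /= -/(dist1 r x) lt_neqAle h1 andbT; apply/eqP => e.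
case: h => h; last by have := gap_sphere1_ge0 x h e; rewrite leNgt g.
by move: g; rewrite [_ < 0](gap_sphere1_lambda1 _ e) ltNge [_ <= _]h.
Qed.

Lemma Ttilde_eball2 x : Tt x -> H2p x \/ 2 * r <= q -> B2 x.
Proof.
move=> /TtildeE[Dx g] h; have /andP[_ h2] := Dx.
rewrite /B2 /eball /= -/(dist2 r x) lt_neqAle h2 andbT; apply/eqP => e.
case: h => h; last by have := gap_sphere2_ge0 x h e; rewrite leNgt g.
by move: g; rewrite [_ < 0](gap_sphere2_lambda2 _ e) ltNge [_ <= _]h.
Qed.

(** * The five regimes *)

Lemma Mup_small : 2 * r <= p -> 2 * r <= q ->
  [/\ [disjoint M & [set center1 n r; center2 n r]],
      closed (M `|` [set center1 n r; center2 n r]),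
      is_disjoint_union (boundary M) [:: T; [set center1 n r; center2 n r]]
    & interior M = Tt].
Proof.
move=> rp rq; have rpq : 2 * r < p + q by rewrite (le_lt_trans rq) // ltrDr.
split.
- apply/disj_setPS => x [Mx []] /=.
    by apply: disjoint_center1; left.
  by apply: disjoint_center2; left.
- suff -> : M `|` [set center1 n r; center2 n r] = closure M by exact: closed_closure.
  apply/seteqP; split=> x.
    by case=> [Mx|[->|->]]; apply/closure_Mup_cases;
      [constructor 1|constructor 2|constructor 3].
  by move=> /closure_Mup_cases[?|[-> _]|[-> _]]; [left | right; left | right; right].
- apply: is_disjoint_union2 => x; last first.
    move=> Tx []; [apply: disjoint_center1 | apply: disjoint_center2]; by right.
  apply: (iff_trans (boundary_Mup_cases _ rpq)); split.
    case=> [|[[-> _]|[-> _]]|/(sphere1_part_empty _ rp)|/(sphere2_part_empty _ rq)] //.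
    + by left.
    + by right; left.
    + by right; right.
  case=> [|[] ->]; first by constructor 1.
    by constructor 2; left.
  by constructor 2; right.
- apply/seteqP; split=> x; first by move=> /interior_MupE[].
  move=> Tx; apply/interior_MupE; split=> //.
    by apply: Ttilde_eball1 => //; right.
  by apply: Ttilde_eball2 => //; right.
Qed.

Lemma Mup_medium : p < 2 * r -> 2 * r <= q ->
  [/\ [disjoint M & [set center1 n r]], closed (M `|` [set center1 n r]),
      is_disjoint_union (boundary M) [:: boundary B1 `&` ~` H1m; T; [set center1 n r]]
    & is_disjoint_union (interior M) [:: B1 `&` ~` H1m; Tt `&` H1m]].
Proof.
move=> rp rq; have rpq : 2 * r < p + q by rewrite (le_lt_trans rq) // ltrDr.
have rpF : 2 * r <= p -> False by rewrite leNgt rp.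
split.
- by apply/disj_setPS => x [Mx /=]; apply: disjoint_center1; left.
- suff -> : M `|` [set center1 n r] = closure M by exact: closed_closure.
  apply/seteqP; split=> x.
    by case=> [Mx|->]; apply/closure_Mup_cases; [constructor 1|constructor 2].
  by move=> /closure_Mup_cases[?|[-> _]|[_ /rpF//]]; [left | right].
- apply: is_disjoint_union3 => x.
    apply: (iff_trans (boundary_Mup_cases _ rpq)); split.
      case=> [|[[-> _]|[_ /rpF//]]||/(sphere2_part_empty _ rq)//].
      + by constructor 2.
      + by constructor 3.
      + by constructor 1.
    case=> [|| ->]; [by constructor 3 | by constructor 1 |].
    by constructor 2; left.
  split.
  + by move=> /(sphere1_part _ rpq)[_ g _] /TsetE[_ _ _ e]; rewrite [G x]e ltxx in g.
  + move=> /(sphere1_part _ rpq)[_ g _] /= e.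
    by rewrite e gap_at_center1 ltxx in g.
  + by move=> Tx; apply: disjoint_center1; right.
- apply: is_disjoint_union2 => x; last by move=> [_ h] [_ /h].
  apply: (iff_trans (interior_MupE x)); split.
    by move=> [Tx b1 b2]; have [h|h] := pselect (H1m x); [right | left].
  case=> [[b1 h]|[Tx h]].
    by have [] := beyond_H1m x rpq b1 h.
  split=> //; first by apply: Ttilde_eball1 => //; left.
  by apply: Ttilde_eball2 => //; right.
Qed.

Lemma Mup_large : p < 2 * r -> q < 2 * r -> 2 * r < p + q ->
  [/\ closed M,
      is_disjoint_union (boundary M)
        [:: boundary B1 `&` ~` H1m; boundary B2 `&` ~` H2p; T]
    & is_disjoint_union (interior M)
        [:: B1 `&` ~` H1m; B2 `&` ~` H2p; Tt `&` (H1m `&` H2p)]].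
Proof.
move=> rp rq rpq.
have rpF : 2 * r <= p -> False by rewrite leNgt rp.
have rqF : 2 * r <= q -> False by rewrite leNgt rq.
have sides x : (~` H1m) x -> (~` H2p) x -> False.
  by move=> /Hminus_compl h1 /Hplus_compl; exact: lambda_disjoint.
split.
- suff -> : M = closure M by exact: closed_closure.
  apply/seteqP; split; first exact: subset_closure.
  by move=> x /closure_Mup_cases[//|[_ /rqF]|[_ /rpF]].
- apply: is_disjoint_union3 => x.
    apply: (iff_trans (boundary_Mup_cases _ rpq)); split.
      case=> [|[[_ /rqF//]|[_ /rpF//]]||].
      + by constructor 3.
      + by constructor 1.
      + by constructor 2.
    by case=> ?; [constructor 3 | constructor 4 | constructor 1].
  split.
  + by move=> [_ h1] [_ h2]; exact: sides h1 h2.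
  + by move=> /(sphere1_part _ rpq)[_ g _] /TsetE[_ _ _ e]; rewrite [G x]e ltxx in g.
  + by move=> /(sphere2_part _ rpq)[_ g _] /TsetE[_ _ _ e]; rewrite [G x]e ltxx in g.
- apply: is_disjoint_union3 => x; last first.
    split; [|by move=> [_ h] [_ [/h]]|by move=> [_ h] [_ [_ /h]]].
    by move=> [_ h1] [_ h2]; exact: sides h1 h2.
  apply: (iff_trans (interior_MupE x)); split.
    move=> [Tx b1 b2]; have [h1|h1] := pselect (H1m x); last by constructor 1.
    by have [h2|h2] := pselect (H2p x); [constructor 3 | constructor 2].
  case=> [[b1 h]|[b2 h]|[Tx [h1 h2]]].
  + by have [] := beyond_H1m x rpq b1 h.
  + by have [] := beyond_H2p x rpq b2 h.
  + by split=> //; [apply: Ttilde_eball1 | apply: Ttilde_eball2] => //; left.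
Qed.

(** The triangle inequality forces [d1 = p] and [d2 = q], which determines the
    first coordinate and leaves no room off the axis. *)
Lemma Mup_tangent : 2 * r = p + q -> M = [set axis_point n ((p - q) / 2)].
Proof.
have [p1 q1] := (p0, q0).
move=> rpq; have rE : r = (p + q) / 2 by lra.
apply/seteqP; split=> x /=; last first.
  by move=> ->; apply: segment_in_Mup; lra.
move=> /MupE[/andP[]]; rewrite -/p -/q => h1 h2 _ _ _.
have tri := dist_triangle r x r0.
have e1 : dist1 r x = p by lra.
have e2 : dist2 r x = q by lra.
have xE : x 0 0 = (p - q) / 2.
  have := dist_sqrB r x; rewrite e1 e2 => e.
  apply: (mulfI (_ : 4 * r != 0)); first by rewrite gt_eqF // mulr_gt0.
  by rewrite -e rE; field.
rewrite -xE; apply: axis_pointP.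
by have := sqr_dist1 r x; rewrite e1 xE rE => e; lra.
Qed.

Lemma Mup_empty : p + q < 2 * r -> M = set0.
Proof.
move=> rpq; apply/seteqP; split=> // x /MupE[/andP[]]; rewrite -/p -/q => h1 h2 _ _ _.
by have := dist_triangle r x r0; lra.
Qed.

End Regions.

Theorem theorem4p10 (R : realType) (n : nat) (r sigma1 sigma2 L : R)
    (r_gt0 : 0 < r) (sigma1_gt0 : 0 < sigma1) (sigma2_gt0 : 0 < sigma2)
    (L_gt0 : 0 < L) (sigma_le : sigma2 <= sigma1) :
  let x1 := center1 n r in
  let x2 := center2 n r in
  let M := Mup n r sigma1 sigma2 L in
  let T := Tset n r sigma1 sigma2 L in
  let Tt := Ttilde n r sigma1 sigma2 L in
  let B1 := eball x1 sigma1 L in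
  let B2 := eball x2 sigma2 L in
  let H1m := Hminus n (lambda1 r sigma1 sigma2 L) in
  let H2p := Hplus n (lambda2 r sigma1 sigma2 L) in
  [/\ (0 < r <= L / (2 * sigma1) ->
        [/\ [disjoint M & [set x1; x2]], closed (M `|` [set x1; x2]),
            is_disjoint_union (boundary M) [:: T; [set x1; x2]]
          & interior M = Tt]),
      (L / (2 * sigma1) < r <= L / (2 * sigma2) ->
        [/\ [disjoint M & [set x1]], closed (M `|` [set x1]),
            is_disjoint_union (boundary M)
              [:: boundary B1 `&` ~` H1m; T; [set x1]]
          & is_disjoint_union (interior M)
              [:: B1 `&` ~` H1m; Tt `&` H1m]]),
      (L / (2 * sigma2) < r < L / 2 * (1 / sigma1 + 1 / sigma2) ->
        [/\ closed M,
            is_disjoint_union (boundary M)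
              [:: boundary B1 `&` ~` H1m; boundary B2 `&` ~` H2p; T]
          & is_disjoint_union (interior M)
              [:: B1 `&` ~` H1m; B2 `&` ~` H2p; Tt `&` (H1m `&` H2p)]]),
      (r = L / 2 * (1 / sigma1 + 1 / sigma2) ->
        M = [set axis_point n (L / 2 * (1 / sigma1 - 1 / sigma2))])
    & (L / 2 * (1 / sigma1 + 1 / sigma2) < r -> M = set0)].
Proof.
move=> x1 x2 M T Tt B1 B2 H1m H2p.
have half s : 0 < s -> L / (2 * s) = (L / s) / 2 by move=> s0; field; rewrite gt_eqF.
have halfD : L / 2 * (1 / sigma1 + 1 / sigma2) = (L / sigma1 + L / sigma2) / 2.
  by field; rewrite !gt_eqF.
have halfB : L / 2 * (1 / sigma1 - 1 / sigma2) = (L / sigma1 - L / sigma2) / 2.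
  by field; rewrite !gt_eqF.
have p_le_q : L / sigma1 <= L / sigma2 by rewrite ler_pM2l // lef_pV2 ?posrE.
rewrite !half // halfD halfB; split.
- by move=> /andP[_ h]; apply: Mup_small => //; lra.
- by move=> /andP[h h']; apply: Mup_medium => //; lra.
- by move=> /andP[h h']; apply: Mup_large => //; lra.
- by move=> h; apply: Mup_tangent => //; lra.
- by move=> h; apply: Mup_empty => //; lra.
Qed.
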